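(* Let $f_i:\mathbb R^m\to\mathbb R$ be $\mathcal C^2$ and $\mu_i$-strongly convex with $l_i$-Lipschitz continuous gradient. Let $\alpha>0$, $\beta\in\mathbb R$, $\gamma>0$, let $(x_i^*,\lambda_i^* )\in\mathbb R^m\times\mathbb R^m$ satisfy $-\alpha\nabla f_i(x_i^* )-\lambda_i^*=\mathbf 0$, and write $\Delta x_i=x_i-x_i^*$, $\Delta\lambda_i=\lambda_i-\lambda_i^*$. Consider the error subsystem $\Sigma_i$ with state $(\Delta x_i,\Delta\lambda_i)$, input $u_i\in\mathbb R^m$ and output $y_i\in\mathbb R^m$: $$\Delta\dot x_i=-\alpha\left(\nabla f_i(x_i)-\nabla f_i(x_i^* )\right)-\Delta\lambda_i+\beta u_i,\qquad \Delta\dot\lambda_i=-\gamma u_i,\qquad y_i=\Delta x_i .$$ Then, for $\eta_i>\frac{1}{\mu_i\alpha\gamma}$, $\Sigma_i$ is input feedforward passive IFP($\nu_i$) from $u_i$ to $y_i$ for some index $\nu_i\le 0$, with respect to the storage function $$V_i=\frac{\eta_i}{2}\|z_i\|^2-\frac1\gamma\Delta x_i^T\Delta\lambda_i+\frac{\alpha}{\gamma}\left(f_i(x_i^* )-f_i(x_i)\right)+\frac\alpha\gamma\nabla f_i(x_i^* )^T\Delta x_i,$$ where $z_i=\alpha\left(\nabla f_i(x_i)-\nabla f_i(x_i^* )\right)+\Delta\lambda_i$.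
   Context: $f_i$ is $\mu_i$-strongly convex ($\mu_i>0$) if $(\nabla f_i(x)-\nabla f_i(y))^T(x-y)\ge\mu_i\|x-y\|^2$ for all $x,y$. A system with state $x$, input $u$ and output $y$ (input and output of the same dimension) is input feedforward passive with index $\nu\in\mathbb R$, denoted IFP($\nu$), with respect to a storage function $V(x)$ if $V$ is continuously differentiable and positive semi-definite and its derivative along the system satisfies $\dot V\le u^Ty-\nu u^Tu$ for all states $x$ and inputs $u$. Throughout, storage functions are considered to be positive definite (in the error state, here $(\Delta x_i,\Delta\lambda_i)$) and radially unbounded. *)

(* Defs.v *)
From HB Require Import structures.
From mathcomp Require Import all_boot all_order all_algebra.
From mathcomp Require Import all_classical all_reals all_analysis.

Set Implicit Arguments.
Unset Strict Implicit.
Unset Printing Implicit Defensive.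

Import Order.TTheory GRing.Theory Num.Theory.
Import numFieldNormedType.Exports.

Local Open Scope classical_set_scope.
Local Open Scope ring_scope.

Definition dot (R : realType) (n : nat) (u v : 'rV[R]_n) : R :=
  (u *m v^T) ord0 ord0.

(* The norm `|u| that the library puts on 'rV[R]_n is the sup norm, so the
   Euclidean norm is defined separately; both induce the same topology. *)
Definition enorm (R : realType) (n : nat) (u : 'rV[R]_n) : R :=
  Num.sqrt (dot u u).

Definition grad (R : realType) (n : nat) (f : 'rV[R]_n -> R) (x : 'rV[R]_n) :
  'rV[R]_n := \row_i 'D_(delta_mx ord0 i) f x.

Definition C1 (R : realType) (n : nat) (f : 'rV[R]_n -> R) : Prop :=
  (forall x, differentiable f x) /\ continuous (grad f).

Definition C2 (R : realType) (n : nat) (f : 'rV[R]_n -> R) : Prop :=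
  C1 f /\ forall i, C1 (fun x => grad f x ord0 i).

Definition strongly_convex (R : realType) (n : nat) (mu : R)
    (f : 'rV[R]_n -> R) : Prop :=
  forall x y, mu * enorm (x - y) ^+ 2 <= dot (grad f x - grad f y) (x - y).

Definition lipschitz_gradient (R : realType) (n : nat) (l : R)
    (f : 'rV[R]_n -> R) : Prop :=
  forall x y, enorm (grad f x - grad f y) <= l * enorm (x - y).

(* x' = dyn x u, y = out x u, with input and output of the same dimension *)
Record system (R : realType) (n p : nat) := System {
  dyn : 'rV[R]_n -> 'rV[R]_p -> 'rV[R]_n;
  out : 'rV[R]_n -> 'rV[R]_p -> 'rV[R]_p
}.

Definition positive_definite (R : realType) (n : nat) (V : 'rV[R]_n -> R) :
  Prop := V 0 = 0 /\ forall x, x != 0 -> 0 < V x.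

Definition radially_unbounded (R : realType) (n : nat) (V : 'rV[R]_n -> R) :
  Prop := forall A : R, exists r : R, forall x, r <= enorm x -> A <= V x.

(* Storage functions are positive definite and radially unbounded throughout,
   which is stronger than the positive semi-definiteness asked for by the usual
   notion of passivity. *)
Definition storage_function (R : realType) (n : nat) (V : 'rV[R]_n -> R) :
  Prop := [/\ C1 V, positive_definite V & radially_unbounded V].

(* The derivative of V along the system, at state x and input u, is the
   derivative of V at x in the direction dyn S x u. *)
Definition IFP (R : realType) (n p : nat) (S : system R n p) (nu : R)
    (V : 'rV[R]_n -> R) : Prop :=
  storage_function V /\
  forall x u, 'D_(dyn S x u) V x <= dot u (out S x u) - nu * dot u u.

(* The error state (Delta x, Delta lambda) is the row vector
   e = row_mx (Delta x) (Delta lambda). *)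
Definition Dx (R : realType) (m : nat) (e : 'rV[R]_(m + m)) : 'rV[R]_m :=
  lsubmx e.

Definition Dlambda (R : realType) (m : nat) (e : 'rV[R]_(m + m)) : 'rV[R]_m :=
  rsubmx e.

Definition error_system (R : realType) (m : nat) (f : 'rV[R]_m -> R)
    (alpha beta gamma : R) (xs : 'rV[R]_m) : system R (m + m) m :=
  System
    (fun e u =>
       row_mx
         (- (alpha *: (grad f (xs + Dx e) - grad f xs)) - Dlambda e + beta *: u)
         (- (gamma *: u)))
    (fun e _ => Dx e).

Definition error_z (R : realType) (m : nat) (f : 'rV[R]_m -> R) (alpha : R)
    (xs : 'rV[R]_m) (e : 'rV[R]_(m + m)) : 'rV[R]_m :=
  alpha *: (grad f (xs + Dx e) - grad f xs) + Dlambda e.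

Definition error_storage (R : realType) (m : nat) (f : 'rV[R]_m -> R)
    (alpha gamma eta : R) (xs : 'rV[R]_m) (e : 'rV[R]_(m + m)) : R :=
  eta / 2 * enorm (error_z f alpha xs e) ^+ 2
  - gamma^-1 * dot (Dx e) (Dlambda e)
  + alpha / gamma * (f xs - f (xs + Dx e))
  + alpha / gamma * dot (grad f xs) (Dx e).

(* Main.v *)
(* Write x, lambda for the error coordinates and g for the gradient increment.
   Replacing lambda by z - alpha g turns the storage function into
   eta/2 |z|^2 - x.z/gamma + (alpha/gamma) D, where D is the Bregman distance
   from xs to xs + x, so that D >= mu/2 |x|^2 by strong convexity.  For
   eta > 1/(mu alpha gamma) the resulting quadratic form in (x, z) is positive
   definite, and |lambda| <= |z| + alpha l |x| carries coercivity over to the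
   error state.  Along the system x' = - z + beta u, hence, with H the Hessian,
   z' = alpha H (- z + beta u) - gamma u and
   V' = - eta alpha z.Hz + |z|^2/gamma + z.w + x.u with
   w = eta alpha beta H u - (eta gamma + beta/gamma) u.  Since mu <= H and
   |H u| <= l |u|, Young's inequality absorbs z.w into the negative definite
   term in z at the price of a multiple of |u|^2. *)

Require Import Defs.
From mathcomp Require Import all_boot all_order all_algebra.
From mathcomp Require Import all_classical all_reals all_analysis.
From mathcomp Require Import ring lra.

Set Implicit Arguments.
Unset Strict Implicit.
Unset Printing Implicit Defensive.

Import Order.TTheory GRing.Theory Num.Theory.
Import numFieldNormedType.Exports.

Local Open Scope classical_set_scope.
Local Open Scope ring_scope.

(** * Euclidean inner product on row vectors *)

Section Dot.
Context {R : realType} {n : nat}.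
Implicit Types u v w : 'rV[R]_n.

Lemma dotE u v : dot u v = \sum_i u ord0 i * v ord0 i.
Proof. by rewrite /dot mxE; apply: eq_bigr => i _; rewrite mxE. Qed.

Lemma dotC u v : dot u v = dot v u.
Proof. by rewrite !dotE; apply: eq_bigr => i _; rewrite mulrC. Qed.

Lemma dotDl u v w : dot (u + v) w = dot u w + dot v w.
Proof. by rewrite /dot mulmxDl mxE. Qed.

Lemma dotZl a u v : dot (a *: u) v = a * dot u v.
Proof. by rewrite /dot -scalemxAl mxE. Qed.

Lemma dotNl u v : dot (- u) v = - dot u v.
Proof. by rewrite -scaleN1r dotZl mulN1r. Qed.

Lemma dotDr u v w : dot u (v + w) = dot u v + dot u w.
Proof. by rewrite dotC dotDl !(dotC u). Qed.

Lemma dotZr a u v : dot u (a *: v) = a * dot u v.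
Proof. by rewrite dotC dotZl dotC. Qed.

Lemma dotNr u v : dot u (- v) = - dot u v.
Proof. by rewrite dotC dotNl dotC. Qed.

Lemma dot0l v : dot 0 v = 0.
Proof. by rewrite -(scale0r 0) dotZl mul0r. Qed.

Lemma dot_ge0 u : 0 <= dot u u.
Proof. by rewrite dotE; apply: sumr_ge0 => i _; rewrite -expr2 sqr_ge0. Qed.

Lemma dot_gt0 u : u != 0 -> 0 < dot u u.
Proof.
move=> u0; rewrite lt_def dot_ge0 andbT; apply: contra u0.
rewrite dotE psumr_eq0 => [/allP u0|i _]; last by rewrite -expr2 sqr_ge0.
apply/eqP/rowP => i; rewrite mxE; apply/eqP.
by have := u0 i; rewrite mem_index_enum mulf_eq0 orbb => /(_ isT).
Qed.

Lemma enorm_sqr u : enorm u ^+ 2 = dot u u.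
Proof. by rewrite /enorm sqr_sqrtr// dot_ge0. Qed.

(** The parallelogram law with the square of [u - v] dropped. *)
Lemma dotDD_le u v : dot (u + v) (u + v) <= 2 * dot u u + 2 * dot v v.
Proof.
have := dot_ge0 (u - v).
rewrite !(dotDl, dotDr, dotNl, dotNr) !(dotC v u); lra.
Qed.

(** Young's inequality: the squared norm of [c u - v / 2] is nonnegative, and dividing its expansion
    by [c] gives the bound. *)
Lemma dot_young c u v : 0 < c ->
  dot u v <= c * dot u u + (4 * c)^-1 * dot v v.
Proof.
move=> c0; have := dot_ge0 (c *: u - 2^-1 *: v).
rewrite !(dotDl, dotDr, dotNl, dotNr, dotZl, dotZr) (dotC v u) => h.
rewrite -subr_ge0.
have -> : c * dot u u + (4 * c)^-1 * dot v v - dot u v =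
  c^-1 * (c * (c * dot u u) + - (c * (2^-1 * dot u v)) +
   (- (2^-1 * (c * dot u v)) + - - (2^-1 * (2^-1 * dot v v)))).
  by field; rewrite gt_eqF.
by apply: mulr_ge0 h; rewrite invr_ge0 ltW.
Qed.

Lemma dot_row_mx (u v u' v' : 'rV[R]_n) :
  dot (row_mx u v) (row_mx u' v') = dot u u' + dot v v'.
Proof. by rewrite /dot tr_row_mx mul_row_col mxE. Qed.

Lemma dot_continuousl w : continuous ((fun u => dot u w)).
Proof.
rewrite (_ : (fun u => _) = fun u => \sum_i u ord0 i * w ord0 i); last first.
  by apply/funext => u; rewrite dotE.
apply: continuous_big => [|i _ u]; first exact: add_continuous.
apply: (@continuousM _ _ (fun u => u ord0 i) (cst _)).
  exact: coord_continuous.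
exact: cst_continuous.
Qed.

Lemma dot_continuous : continuous (fun u => dot u u).
Proof.
rewrite (_ : (fun u => _) = fun u => \sum_i u ord0 i * u ord0 i); last first.
  by apply/funext => u; rewrite dotE.
apply: continuous_big => [|i _ u]; first exact: add_continuous.
by apply: (@continuousM _ _ (fun u => u ord0 i)); exact: coord_continuous.
Qed.

End Dot.

(** A neighbourhood of a row vector contains a product of entrywise neighbourhoods, and finitely
    many entries can be controlled at once. *)
Lemma cvg_row (R : realType) (n : nat) (T : Type) (F : set_system T)
    {FF : Filter F} (u : T -> 'rV[R]_n) (l : 'rV[R]_n) :
  (forall i, u t ord0 i @[t --> F] --> l ord0 i) -> u @ F --> l.
Proof.
move=> ul A [P lP PA]; rewrite nbhs_filterE.
have : \forall t \near F, forall i, P ord0 i (u t ord0 i).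
  by apply: filter_forall => i; exact: ul (lP ord0 i).
by apply: filterS => t Pt; apply: PA => i j; rewrite (ord1 i).
Qed.

(** * Directional derivatives and closure properties of the class [C1] *)

Section Directional.
Context {R : realType} {n : nat}.
Implicit Types (f g : 'rV[R]_n -> R) (x v : 'rV[R]_n).

Lemma derive_grad f x v : differentiable f x -> 'D_v f x = dot (grad f x) v.
Proof.
move=> df; rewrite deriveE// {1}(row_sum_delta v) linear_sum/= dotE.
by apply: eq_bigr => i _; rewrite linearZ/= mxE deriveE// mulrC.
Qed.

(** Testing the gradient against a fixed vector turns its continuity into that of directional
    derivatives, to which the scalar sum and product rules apply. Basis vectors recover the
    coordinates. *)
Lemma C1P f : C1 f <-> (forall x, differentiable f x) /\
                       forall v, continuous (fun x => dot (grad f x) v).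
Proof.
split=> -[df cf]; split=> //.
  move=> v x; apply: (@continuous_comp _ _ _ (grad f) (fun u => dot u v)).
    exact: cf.
  exact: dot_continuousl.
move=> x; apply: (@cvg_row _ _ _ (nbhs x)) => i.
have gradE y : grad f y ord0 i = dot (grad f y) (delta_mx ord0 i).
  by rewrite -derive_grad// mxE.
by rewrite gradE (_ : (fun t => _) = fun y => dot (grad f y) (delta_mx ord0 i));
  [exact: cf|exact/funext].
Qed.

Lemma C1_derivable f x v : C1 f -> is_derive x v f ('D_v f x).
Proof. by move=> [df _]; apply: derivableP; exact: diff_derivable. Qed.

Lemma C1_continuous f : C1 f -> continuous f.
Proof. by move=> [df _] x; exact: differentiable_continuous. Qed.

Lemma C1_cst (a : R) : C1 (fun _ : 'rV[R]_n => a).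
Proof.
apply/C1P; split=> [x|v]; first exact: differentiable_cst.
rewrite (_ : (fun x => dot _ _) = cst 0); first exact: cst_continuous.
by apply/funext => x; rewrite -derive_grad ?derive_cst//;
  exact: differentiable_cst.
Qed.

Lemma is_derive_coord i x v : is_derive x v (fun x => x ord0 i) (v ord0 i).
Proof.
(* Bundled as a continuous linear map, the coordinate projection is its own differential. *)
have @c : {linear 'rV[R]_n -> R}.
  by exists (fun x => x ord0 i); do 2![eexists]; do ?[constructor];
     rewrite ?mxE// => ? *; rewrite ?mxE//; move=> ?; rewrite !mxE.
have dc : differentiable c x by exact: differentiable_coord.
apply: (@DeriveDef _ _ _ x v c); first exact: diff_derivable.
by rewrite deriveE// diff_lin//; exact: coord_continuous.
Qed.

Lemma C1_coord i : C1 (fun x => x ord0 i).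
Proof.
apply/C1P; split=> [x|v]; first exact: differentiable_coord.
rewrite (_ : (fun x => dot _ _) = cst (v ord0 i)); first exact: cst_continuous.
apply/funext => x; rewrite -derive_grad; last exact: differentiable_coord.
by have [] := is_derive_coord i x v.
Qed.

Lemma C1D f g : C1 f -> C1 g -> C1 (fun x => f x + g x).
Proof.
move=> f1 g1; have [df cf] := (C1P f).1 f1; have [dg cg] := (C1P g).1 g1.
apply/C1P; split=> [x|v]; first exact: differentiableD.
rewrite (_ : (fun x => dot _ _) = fun x => dot (grad f x) v + dot (grad g x) v).
  by move=> x; exact: (cvgD (cf v x) (cg v x)).
apply/funext => x; rewrite -!derive_grad//; last exact: differentiableD.
by apply: deriveD; exact: diff_derivable.
Qed.

Lemma C1M f g : C1 f -> C1 g -> C1 (fun x => f x * g x).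
Proof.
move=> f1 g1; have [df cf] := (C1P f).1 f1; have [dg cg] := (C1P g).1 g1.
apply/C1P; split=> [x|v]; first exact: differentiableM.
rewrite (_ : (fun x => dot _ _) =
    fun x => f x * dot (grad g x) v + g x * dot (grad f x) v).
  move=> x; exact: (cvgD (cvgM (@C1_continuous _ f1 x) (cg v x))
    (cvgM (@C1_continuous _ g1 x) (cf v x))).
apply/funext => x; rewrite -!derive_grad//; last exact: differentiableM.
by apply: deriveM; exact: diff_derivable.
Qed.

Lemma C1_dot k (p q : 'rV[R]_n -> 'rV[R]_k) :
  (forall i, C1 (fun x => p x ord0 i)) ->
  (forall i, C1 (fun x => q x ord0 i)) -> C1 (fun x => dot (p x) (q x)).
Proof.
move=> p1 q1.
rewrite (_ : (fun x => _) = \sum_i (fun x => p x ord0 i * q x ord0 i)).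
  elim/big_ind: _ => [|h h' h1 h1'|i _]; [exact: C1_cst|exact: C1D|exact: C1M].
by apply/funext => x; rewrite fct_sumE dotE.
Qed.

Lemma is_derive_dot k (p q : 'rV[R]_n -> 'rV[R]_k) x v (dp dq : 'rV[R]_k) :
  (forall i, is_derive x v (fun x => p x ord0 i) (dp ord0 i)) ->
  (forall i, is_derive x v (fun x => q x ord0 i) (dq ord0 i)) ->
  is_derive x v (fun x => dot (p x) (q x)) (dot dp (q x) + dot (p x) dq).
Proof.
move=> p1 q1.
rewrite (_ : (fun x => _) = \sum_i (fun x => p x ord0 i * q x ord0 i)).
  apply: is_derive_eq; rewrite !dotE -big_split/=; apply: eq_bigr => i _.
  by rewrite addrC; congr (_ + _); exact: mulrC.
by apply/funext => y; rewrite fct_sumE dotE.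
Qed.

End Directional.

(** * Composition with affine maps and restriction to lines *)

Section AffineComposition.
Context {R : realType} {n k : nat}.
Variables (L : {linear 'rV[R]_k -> 'rV[R]_n}) (a : 'rV[R]_n).
Implicit Types (f : 'rV[R]_n -> R).
Hypothesis cL : continuous L.

(** As [L] is linear, the two difference quotients agree for every [h], hence so do their limits. *)
Lemma derive_affine f x v :
  'D_v (fun x => f (a + L x)) x = 'D_(L v) f (a + L x).
Proof.
apply: (congr1 (fun F : R -> R => lim (F h @[h --> 0^'])%classic)).
apply/funext => h /=.
by rewrite (linearD L) (linearZ _ v)/= addrCA.
Qed.

Lemma C1_affine f : C1 f -> C1 (fun x => f (a + L x)).
Proof.
move=> /C1P[df cf].
have dfL x : differentiable (fun x => f (a + L x)) x.
  apply: (@differentiable_comp _ _ _ _ (fun x => a + L x)) => //.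
  apply: differentiableD; first exact: differentiable_cst.
  exact: linear_differentiable.
apply/C1P; split=> // v.
rewrite (_ : (fun x => dot _ _) = fun x => dot (grad f (a + L x)) (L v)).
  move=> x; apply: (@continuous_comp _ _ _ (fun x => a + L x)
    (fun y => dot (grad f y) (L v))).
    exact: (cvgD (cvg_cst a) (@cL x)).
  exact: cf.
by apply/funext => x; rewrite -!derive_grad// derive_affine.
Qed.

Lemma is_derive_affine f x v : C1 f ->
  is_derive x v (fun x => f (a + L x)) (dot (grad f (a + L x)) (L v)).
Proof.
move=> f1; apply: (is_derive_eq (C1_derivable x v (C1_affine f1))).
by rewrite derive_affine derive_grad//; exact: f1.1.
Qed.

End AffineComposition.

(** Reduces [f] to one real variable, as the mean value theorem requires. The difference quotient at
    [t] is that of [f] at [x + t *: d] in direction [d]. *)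
Lemma is_derive_line (R : realType) (n : nat) (f : 'rV[R]_n -> R)
    (x d : 'rV[R]_n) (t : R) : differentiable f (x + t *: d) ->
  is_derive t (1 : R) (fun s => f (x + s *: d)) (dot (grad f (x + t *: d)) d).
Proof.
move=> df.
have E : (fun h : R => h^-1 *: (((fun s => f (x + s *: d)) \o shift t) (h *: 1)
                              - f (x + t *: d)))
       = (fun h : R => h^-1 *: ((f \o shift (x + t *: d)) (h *: d)
                              - f (x + t *: d))).
  by apply/funext => h /=; rewrite scaler1 scalerDl addrCA.
apply: DeriveDef; first by rewrite /derivable E; exact: diff_derivable.
by rewrite -derive_grad// /derive E.
Qed.

(** * First- and second-order consequences of strong convexity and of the Lipschitz gradient *)

Section StronglyConvex.
Context {R : realType} {n : nat}.
Variables (f : 'rV[R]_n -> R) (mu l : R).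
Implicit Types x d v : 'rV[R]_n.

(** Mean value theorem on [0, 1] for [phi], the gap between [f] along the segment and its quadratic
    lower model. Strong convexity between [x + c *: d] and [x], divided by [c > 0], says that
    [dphi c] is nonnegative. *)
Lemma strongly_convex_lb x d : (forall y, differentiable f y) ->
  strongly_convex mu f ->
  f x + dot (grad f x) d + mu / 2 * dot d d <= f (x + d).
Proof.
move=> df fcvx.
pose phi t := f (x + t *: d) - (t * dot (grad f x) d + mu / 2 * t ^+ 2 * dot d d).
pose dphi t := dot (grad f (x + t *: d)) d
  - (dot (grad f x) d + mu * t * dot d d).
have Dphi t : is_derive t (1 : R) phi (dphi t).
  have fl := is_derive_line (df (x + t *: d)).
  have Did := is_derive_id t (1 : R).
  have Dq := is_deriveD (is_deriveM Did (is_derive_cst (dot (grad f x) d) t 1))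
    (is_deriveM (is_deriveX 2 Did) (is_derive_cst (mu / 2 * dot d d) t 1)).
  rewrite (_ : phi = (fun s => f (x + s *: d)) -
    (id * cst (dot (grad f x) d) + id ^+ 2 * cst (mu / 2 * dot d d))).
    apply: (is_derive_eq (is_deriveB fl Dq)); rewrite /dphi.
    by rewrite !scaler0 /cst /GRing.scale/=; field.
  by apply/funext => s; rewrite /phi !fctE /=; ring.
have [|c c01] := @MVT _ phi dphi 0 1 ltr01 (fun t _ => Dphi t).
  apply: derivable_within_continuous => t _.
  by have [] := Dphi t.
have c0 : 0 < c by move: c01; rewrite in_itv => /andP[].
have := fcvx (x + c *: d) x.
rewrite enorm_sqr addrAC subrr add0r dotZl !dotZr dotDl dotNl.
rewrite mulrCA ler_pM2l// /phi /dphi !scale1r scale0r addr0 => h1 h2.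
by lra.
Qed.

Lemma lipschitz_gradient_sqr x y : lipschitz_gradient l f ->
  dot (grad f x - grad f y) (grad f x - grad f y) <= l ^+ 2 * dot (x - y) (x - y).
Proof.
move=> flip; rewrite -!enorm_sqr -exprMn ler_sqr ?nnegrE ?sqrtr_ge0//.
(* Squaring needs [l * enorm (x - y)] to be nonnegative; it is, since it dominates a norm. *)
by apply: le_trans (flip x y); exact: sqrtr_ge0.
Qed.

(** The Hessian of [f] at [x] applied to [v]. *)
Definition grad_deriv x v : 'rV[R]_n :=
  \row_i 'D_v (fun y => grad f y ord0 i) x.

Hypothesis f_C2 : C2 f.

(** Lets inequalities on gradient increments pass to the limit as inequalities on the Hessian. *)
Lemma grad_deriv_cvg x v :
  h^-1 *: (grad f (h *: v + x) - grad f x) @[h --> 0^'] --> grad_deriv x v.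
Proof.
apply: cvg_row => i; rewrite mxE.
rewrite (_ : (fun h => _) = fun h => h^-1 *:
  (((fun y => grad f y ord0 i) \o shift x) (h *: v) - grad f x ord0 i)).
  by apply: diff_derivable; have [] := f_C2.2 i.
by apply/funext => h /=; rewrite !mxE.
Qed.

(** Strong convexity between [t *: v + x] and [x], divided by [t ^+ 2], in the limit [t -> 0]. *)
Lemma strongly_convex_grad_deriv x v : strongly_convex mu f ->
  mu * dot v v <= dot (grad_deriv x v) v.
Proof.
move=> fcvx.
have h := cvg_comp _ _ (@grad_deriv_cvg x v)
  (@dot_continuousl _ _ v (grad_deriv x v)).
apply: (cvgr_to_ge h); near=> t => /=.
have t0 : t != 0 by near: t; exact: nbhs_dnbhs_neq.
have := fcvx (t *: v + x) x.
rewrite enorm_sqr addrK dotZl !dotZr => k; rewrite dotZl.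
rewrite (_ : _^-1 * _ = t * dot (grad f (t *: v + x) - grad f x) v / t ^+ 2).
  by rewrite ler_pdivlMr ?exprn_even_gt0//; apply: le_trans k; lra.
by field.
Unshelve. all: by end_near. Qed.

(** The same limit, now for the squared Lipschitz bound. *)
Lemma lipschitz_grad_deriv x v : lipschitz_gradient l f ->
  dot (grad_deriv x v) (grad_deriv x v) <= l ^+ 2 * dot v v.
Proof.
move=> flip.
have h := cvg_comp _ _ (@grad_deriv_cvg x v)
  (@dot_continuous _ _ (grad_deriv x v)).
apply: (cvgr_to_le h); near=> t => /=.
have t0 : t != 0 by near: t; exact: nbhs_dnbhs_neq.
have := lipschitz_gradient_sqr (t *: v + x) x flip.
set w := grad f _ - _; rewrite addrK !dotZl !dotZr => k; rewrite ?(dotZl, dotZr).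
rewrite (_ : _^-1 * _ = dot w w / t ^+ 2); last by field.
by rewrite ler_pdivrMr ?exprn_even_gt0//; apply: le_trans k _; lra.
Unshelve. all: by end_near. Qed.

End StronglyConvex.

(** One quadratic lower bound on [V] yields both positive definiteness and radial unboundedness. *)
Lemma coercive_storage (R : realType) (n : nat) (V : 'rV[R]_n -> R) (c : R) :
  0 < c -> C1 V -> V 0 = 0 -> (forall e, dot e e <= c * V e) ->
  storage_function V.
Proof.
move=> c0 V1 V0 cV; split=> //; first split=> // e e0.
  by rewrite -(pmulr_rgt0 _ c0); exact: lt_le_trans (dot_gt0 e0) (cV e).
move=> A; exists (Num.sqrt (c * `|A|)) => e.
rewrite /enorm ler_sqrt ?dot_ge0// => Ae.
apply: le_trans (ler_norm A) _.
by rewrite -(ler_pM2l c0); exact: le_trans Ae (cV e).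
Qed.

Lemma quadratic_form_coercive (R : realType) (mu alpha gamma eta : R) :
  0 < mu -> 0 < alpha -> 0 < gamma -> 1 / (mu * alpha * gamma) < eta ->
  exists p q : R, [/\ 0 < p, 0 < q & forall n (x z : 'rV[R]_n),
    p * dot x x + q * dot z z <=
    eta / 2 * dot z z - gamma^-1 * dot x z + alpha / gamma * (mu / 2) * dot x x].
Proof.
move=> mu0 al0 ga0 h.
have mag0 : 0 < mu * alpha * gamma by rewrite !mulr_gt0.
have eta0 : 0 < eta by apply: lt_trans h; rewrite divr_gt0.
have ge0 : 0 < 2 * gamma * eta by rewrite !mulr_gt0.
have h' : 1 < eta * (mu * alpha * gamma) by rewrite -ltr_pdivrMr.
have lo : (2 * gamma * eta)^-1 < mu * alpha / 2.
  by rewrite -[ltLHS]mul1r ltr_pdivrMr//; lra.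
(* [c] is the weight in Young's inequality for the cross term; the interval is
   nonempty exactly when [eta] exceeds [1 / (mu alpha gamma)]. *)
have [c c_lo c_hi] : exists2 c, (2 * gamma * eta)^-1 < c & c < mu * alpha / 2.
  by exists (((2 * gamma * eta)^-1 + mu * alpha / 2) / 2); lra.
have c0 : 0 < c by apply: lt_trans c_lo; rewrite invr_gt0.
(* These are the parts of the two squares that survive Young's inequality: the upper bound on [c]
   makes the first positive, the lower bound the second. *)
exists (alpha / gamma * (mu / 2) - gamma^-1 * c).
exists (eta / 2 - gamma^-1 * (4 * c)^-1); split.
- rewrite (_ : _ - _ = gamma^-1 * (mu * alpha / 2 - c)); last by ring.
  by rewrite mulr_gt0 ?invr_gt0// subr_gt0.
- have c1 : 1 < c * (2 * gamma * eta).
    by rewrite -ltr_pdivrMr// mul1r.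
  rewrite (_ : _ - _ = (c * (2 * gamma * eta) - 1) / (4 * gamma * c)).
    by apply: divr_gt0; [rewrite subr_gt0|rewrite !mulr_gt0// ltr0n].
  by field; rewrite !gt_eqF.
move=> n x z; have := dot_young x z c0.
rewrite -(@ler_pM2l _ gamma^-1) ?invr_gt0// => k; lra.
Qed.

(** * The error system: regularity, coercivity and dissipation of its storage function *)

Section ErrorSystem.
Context {R : realType} {m : nat}.
Variables (f : 'rV[R]_m -> R) (mu l alpha beta gamma eta : R) (xs : 'rV[R]_m).
Hypothesis f_C2 : C2 f.
Implicit Types (x u v : 'rV[R]_m) (e w : 'rV[R]_(m + m)).

Local Notation z := (error_z f alpha xs).
Local Notation V := (error_storage f alpha gamma eta xs).

(** Exhibits each Hessian coordinate as an inner product with [v], whence linearity in [v]. *)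
Lemma grad_derivE x v i :
  grad_deriv f x v ord0 i = dot (grad (fun y => grad f y ord0 i) x) v.
Proof. by rewrite mxE derive_grad//; exact: (f_C2.2 i).1. Qed.

Lemma grad_derivD x u v :
  grad_deriv f x (u + v) = grad_deriv f x u + grad_deriv f x v.
Proof. by apply/rowP => i; rewrite grad_derivE dotDr -2!grad_derivE [RHS]mxE. Qed.

Lemma grad_derivZ x a v : grad_deriv f x (a *: v) = a *: grad_deriv f x v.
Proof. by apply/rowP => i; rewrite grad_derivE dotZr -grad_derivE [RHS]mxE. Qed.

(** A form built only from sums and products, with signs moved into constants, to match the rules
    for [C1] and [is_derive]. *)
Lemma error_storageE :
  V = fun e => eta / 2 * dot (z e) (z e)
    + (- gamma^-1 * dot (Dx e) (Dlambda e)
    + (alpha / gamma * (f xs + -1 * f (xs + Dx e))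
    + alpha / gamma * dot (grad f xs) (Dx e))).
Proof.
apply/funext => e; rewrite /error_storage enorm_sqr; ring.
Qed.

Lemma error_zE e i : z e ord0 i =
  alpha * (grad f (xs + Dx e) ord0 i + - grad f xs ord0 i) + Dlambda e ord0 i.
Proof. by rewrite !mxE. Qed.

Lemma C1_Dx i : C1 (fun e => Dx e ord0 i).
Proof.
rewrite (_ : (fun e => _) = fun e => e ord0 (lshift m i)); first exact: C1_coord.
by apply/funext => e; rewrite mxE.
Qed.

Lemma C1_Dlambda i : C1 (fun e => Dlambda e ord0 i).
Proof.
rewrite (_ : (fun e => _) = fun e => e ord0 (rshift m i)); first exact: C1_coord.
by apply/funext => e; rewrite mxE.
Qed.

Lemma is_derive_Dx e w i : is_derive e w (fun e => Dx e ord0 i) (Dx w ord0 i).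
Proof.
rewrite (_ : (fun e => _) = fun e => e ord0 (lshift m i)); last first.
  by apply/funext => e'; rewrite mxE.
by rewrite mxE; exact: is_derive_coord.
Qed.

Lemma is_derive_Dlambda e w i :
  is_derive e w (fun e => Dlambda e ord0 i) (Dlambda w ord0 i).
Proof.
rewrite (_ : (fun e => _) = fun e => e ord0 (rshift m i)); last first.
  by apply/funext => e'; rewrite mxE.
by rewrite mxE; exact: is_derive_coord.
Qed.

Lemma C1_error_z i : C1 (fun e => z e ord0 i).
Proof.
rewrite (_ : (fun e => _) = fun e =>
  alpha * (grad f (xs + Dx e) ord0 i + - grad f xs ord0 i) + Dlambda e ord0 i).
  apply: C1D (C1_Dlambda i); apply: C1M; first exact: C1_cst.
  apply: C1D; last exact: C1_cst.
  exact: (C1_affine xs (@continuous_lsubmx _ _ _ _) (f_C2.2 i)).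
by apply/funext => e; rewrite error_zE.
Qed.

Lemma C1_error_storage : C1 V.
Proof.
rewrite error_storageE; apply: C1D.
  apply: C1M; first exact: C1_cst.
  by apply: C1_dot => i; exact: C1_error_z.
apply: C1D.
  apply: C1M; first exact: C1_cst.
  by apply: C1_dot => i; [exact: C1_Dx|exact: C1_Dlambda].
apply: C1D; (apply: C1M; first exact: C1_cst).
  apply: C1D; first exact: C1_cst.
  apply: C1M; first exact: C1_cst.
  exact: (C1_affine xs (@continuous_lsubmx _ _ _ _) f_C2.1).
by apply: C1_dot => i; [exact: C1_cst|exact: C1_Dx].
Qed.

Lemma is_derive_error_z e w i : is_derive e w (fun e => z e ord0 i)
  ((alpha *: grad_deriv f (xs + Dx e) (Dx w) + Dlambda w) ord0 i).
Proof.
rewrite (_ : (fun e => _) = cst alpha *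
  ((fun e => grad f (xs + Dx e) ord0 i) + cst (- grad f xs ord0 i)) +
  (fun e => Dlambda e ord0 i)).
  have h := is_derive_affine xs (@continuous_lsubmx _ _ _ _) e w (f_C2.2 i).
  apply: (is_derive_eq (is_deriveD (is_deriveM (is_derive_cst alpha e w)
    (is_deriveD h (is_derive_cst _ e w))) (is_derive_Dlambda e w i))).
  by rewrite scaler0 !addr0 [RHS]mxE [in RHS]mxE grad_derivE.
by apply/funext => e'; rewrite error_zE.
Qed.

(** The terms in [f] are designed for this: their derivative and the [Dx w] part of the cross term
    combine into a multiple of [dot (z e) (Dx w)]. *)
Lemma derive_error_storage e w : 'D_w V e =
  eta * dot (z e) (alpha *: grad_deriv f (xs + Dx e) (Dx w) + Dlambda w)
  - gamma^-1 * (dot (z e) (Dx w) + dot (Dx e) (Dlambda w)).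
Proof.
have hf : is_derive e w (fun e => f (xs + Dx e))
    (dot (grad f (xs + Dx e)) (Dx w)).
  exact: (is_derive_affine xs (@continuous_lsubmx _ _ _ _) e w f_C2.1).
have hz := is_derive_dot (is_derive_error_z e w) (is_derive_error_z e w).
have hxl := is_derive_dot (is_derive_Dx e w) (is_derive_Dlambda e w).
have hx : is_derive e w (fun e => dot (grad f xs) (Dx e))
    (dot 0 (Dx e) + dot (grad f xs) (Dx w)).
  apply: is_derive_dot => i; last exact: is_derive_Dx.
  have -> : (0 : 'rV[R]_m) ord0 i = 0 by rewrite mxE.
  exact: is_derive_cst.
have cM (a : R) g dg : is_derive e w g dg -> is_derive e w (cst a * g) (a * dg).
  move=> h; apply: (is_derive_eq (is_deriveM (is_derive_cst a e w) h)).
  by rewrite scaler0 addr0.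
have hV := is_deriveD (cM (eta / 2) _ _ hz) (is_deriveD (cM (- gamma^-1) _ _ hxl)
  (is_deriveD (cM (alpha / gamma) _ _ (is_deriveD (is_derive_cst (f xs) e w)
    (cM (-1) _ _ hf))) (cM (alpha / gamma) _ _ hx))).
rewrite error_storageE; have [_ ->] := hV.
rewrite (dotC _ (z e)) dot0l.
have -> : dot (z e) (Dx w) = alpha * (dot (grad f (xs + Dx e)) (Dx w)
    - dot (grad f xs) (Dx w)) + dot (Dlambda e) (Dx w).
  by rewrite dotDl dotZl dotDl dotNl.
rewrite (dotC (Dx w) (Dlambda e)).
by lra.
Qed.

Lemma error_storage_lb e : 0 < alpha -> 0 < gamma -> strongly_convex mu f ->
  eta / 2 * dot (z e) (z e) - gamma^-1 * dot (Dx e) (z e)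
  + alpha / gamma * (mu / 2) * dot (Dx e) (Dx e) <= V e.
Proof.
move=> al0 ga0 fcvx.
(* Once [Dlambda e] is eliminated, the remaining Bregman distance is based at the displaced point
   [xs + Dx e], so the bound is taken there in direction [- Dx e]. *)
have := strongly_convex_lb (xs + Dx e) (- Dx e) f_C2.1.1 fcvx.
rewrite addrK dotNl !dotNr opprK => h.
have : 0 <= alpha / gamma * (f xs - (f (xs + Dx e) -
  dot (grad f (xs + Dx e)) (Dx e) + mu / 2 * dot (Dx e) (Dx e))).
  by rewrite mulr_ge0 ?subr_ge0// divr_ge0// ltW.
rewrite /error_storage enorm_sqr.
have -> : Dlambda e = z e - alpha *: (grad f (xs + Dx e) - grad f xs).
  by rewrite /error_z addrC addKr.
rewrite dotDr dotNr dotZr dotDr dotNr !(dotC (Dx e) (grad f _)); lra.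
Qed.

(** [Dlambda e] is [z e] minus [alpha] times a gradient increment of norm at most [l] times that of
    [Dx e]; the factors 2 come from [dotDD_le]. *)
Lemma error_state_le e : lipschitz_gradient l f ->
  dot e e <= 2 * dot (z e) (z e)
    + (1 + 2 * alpha ^+ 2 * l ^+ 2) * dot (Dx e) (Dx e).
Proof.
move=> flip.
have {1 2}-> : e = row_mx (Dx e) (Dlambda e) by rewrite hsubmxK.
rewrite dot_row_mx.
have -> : Dlambda e = z e - alpha *: (grad f (xs + Dx e) - grad f xs).
  by rewrite /error_z addrC addKr.
have := dotDD_le (z e) (- (alpha *: (grad f (xs + Dx e) - grad f xs))).
rewrite dotNl dotNr dotZl dotZr.
have := lipschitz_gradient_sqr (xs + Dx e) xs flip.
rewrite (addrC xs) addrK => /(ler_wpM2l (sqr_ge0 alpha)).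
lra.
Qed.

(** By strong convexity the quadratic part in [z] is at most [- c] times its squared norm. Young's
    inequality with this same weight [c] cancels it completely and leaves [(4 * c)^-1 * dot w w]. *)
Lemma error_system_dissipation e u :
  strongly_convex mu f -> lipschitz_gradient l f ->
  0 < alpha -> 0 < gamma -> 0 < eta -> 0 < eta * alpha * mu - gamma^-1 ->
  'D_(dyn (error_system f alpha beta gamma xs) e u) V e <= dot u (Dx e) +
    (4 * (eta * alpha * mu - gamma^-1))^-1
    * (2 * (eta * alpha * beta) ^+ 2 * l ^+ 2
     + 2 * (eta * gamma + beta / gamma) ^+ 2) * dot u u.
Proof.
move=> fcvx flip al0 ga0 eta0 c0.
set H := grad_deriv f (xs + Dx e).
have Hz := strongly_convex_grad_deriv f_C2 (xs + Dx e) (z e) fcvx.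
have Hu := lipschitz_grad_deriv f_C2 (xs + Dx e) u flip.
set c := _ - gamma^-1 in c0 *.
(* [w] gathers all input terms that are paired with [z e] in the derivative. *)
pose w := (eta * alpha * beta) *: H u - (eta * gamma + beta / gamma) *: u.
have young := dot_young (z e) w c0.
have ww := dotDD_le ((eta * alpha * beta) *: H u)
  (- ((eta * gamma + beta / gamma) *: u)).
rewrite -/w dotNl dotNr opprK 2!dotZl 2!dotZr in ww.
have c4 : 0 <= (4 * c)^-1 by rewrite invr_ge0 mulr_ge0// ltW.
have {}Hu := ler_wpM2l (sqr_ge0 (eta * alpha * beta)) Hu.
have {}ww : dot w w <= (2 * (eta * alpha * beta) ^+ 2 * l ^+ 2
     + 2 * (eta * gamma + beta / gamma) ^+ 2) * dot u u.
  by apply: le_trans ww _; rewrite /H; lra.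
have {}ww := ler_wpM2l c4 ww.
have {}Hz := ler_wpM2l (ltW (mulr_gt0 eta0 al0)) Hz.
rewrite derive_error_storage /= /Dx row_mxKl /Dlambda row_mxKr -/(Dx e).
rewrite (_ : - _ - _ + _ = - 1 *: z e + beta *: u); last first.
  by rewrite scaleN1r /error_z opprD.
rewrite grad_derivD !grad_derivZ -/H.
rewrite -/H in Hz; move: (z e) Hz young => Z Hz young {Hu}.
(* [H] must be opaque, or matching [dotZr] unfolds it as a matrix. *)
clearbody H.
have Zw : dot Z w = eta * alpha * beta * dot Z (H u)
    - (eta * gamma + beta / gamma) * dot Z u.
  by rewrite /w dotDr dotNr !dotZr.
rewrite Zw in young; rewrite (dotC (H Z)) in Hz.
(* Cancels [gamma] in the product of [Dx e] with the [lambda] equation, which yields the supply rate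
   [dot u (Dx e)]. *)
have gK := mulKf (lt0r_neq0 ga0) (dot u (Dx e)).
rewrite (dotDr Z) (dotDr Z (_ *: Z)) dotNr !dotZr dotDr !dotZr dotNr dotZr.
rewrite (dotC (Dx e)).
(* With the inverse generalized to [k], [c] can be unfolded elsewhere and the goal is linear in its
   monomials. *)
move: (4 * c)^-1 c4 ww young => k _ ww; rewrite /c => young.
lra.
Qed.

End ErrorSystem.

Theorem lemma2 (R : realType) (m : nat) (f : 'rV[R]_m -> R)
    (mu l alpha beta gamma eta : R) (xs lambdas : 'rV[R]_m)
    (f_C2 : C2 f)
    (mu_gt0 : 0 < mu) (f_convex : strongly_convex mu f)
    (f_lipschitz : lipschitz_gradient l f)
    (alpha_gt0 : 0 < alpha) (gamma_gt0 : 0 < gamma)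
    (equilibrium : - (alpha *: grad f xs) - lambdas = 0)
    (eta_gt : 1 / (mu * alpha * gamma) < eta) :
  exists nu : R, nu <= 0 /\
    IFP (error_system f alpha beta gamma xs) nu
        (error_storage f alpha gamma eta xs).

Proof.
have [p [q [p0 q0 lb]]] :=
  quadratic_form_coercive mu_gt0 alpha_gt0 gamma_gt0 eta_gt.
have mag0 : 0 < mu * alpha * gamma by rewrite !mulr_gt0.
have eta0 : 0 < eta by apply: lt_trans eta_gt; rewrite divr_gt0.
(* This is the bound on [eta] multiplied by [mu * alpha]. *)
have c0 : 0 < eta * alpha * mu - gamma^-1.
  rewrite subr_gt0 -[ltLHS]mul1r ltr_pdivrMr//.
  by move: eta_gt; rewrite ltr_pdivrMr//; lra.
set c := eta * alpha * mu - gamma^-1 in c0.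
(* The index is minus the coefficient of [dot u u] left over in [error_system_dissipation]. *)
exists (- ((4 * c)^-1 * (2 * (eta * alpha * beta) ^+ 2 * l ^+ 2
     + 2 * (eta * gamma + beta / gamma) ^+ 2))); split; last split.
- rewrite oppr_le0; apply: mulr_ge0.
    by rewrite invr_ge0 mulr_ge0// ltW.
  by rewrite -mulrA -exprMn addr_ge0// mulr_ge0 ?sqr_ge0.
- have k0 : 0 <= 1 + 2 * alpha ^+ 2 * l ^+ 2.
    by rewrite -mulrA -exprMn addr_ge0// mulr_ge0 ?sqr_ge0.
  (* The constant results from inserting the bounds [V / q] on the square of [z] and [V / p] on that
     of [Dx e] into [error_state_le]. *)
  apply: (@coercive_storage _ _ _ (2 / q + (1 + 2 * alpha ^+ 2 * l ^+ 2) / p)).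
  + by rewrite ltr_wpDr ?divr_gt0// divr_ge0// ltW.
  + exact: C1_error_storage.
  + have D0 : Dx (0 : 'rV[R]_(m + m)) = 0 by exact: linear0.
    have L0 : Dlambda (0 : 'rV[R]_(m + m)) = 0 by exact: linear0.
    rewrite /error_storage enorm_sqr /error_z D0 L0 !addr0 subrr scaler0.
    by rewrite subrr !(dotC _ 0) !dot0l !mulr0 subr0 !addr0.
  + move=> e; apply: le_trans (error_state_le alpha xs e f_lipschitz) _.
    have V_ge := le_trans (lb _ (Dx e) (error_z f alpha xs e))
      (error_storage_lb eta xs f_C2 e alpha_gt0 gamma_gt0 f_convex).
    set V := error_storage _ _ _ _ _ _ in V_ge *.
    have zV : dot (error_z f alpha xs e) (error_z f alpha xs e) <= q^-1 * V.
      rewrite mulrC ler_pdivlMr// mulrC; apply: le_trans V_ge.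
      by rewrite lerDr mulr_ge0 ?dot_ge0// ltW.
    have xV : dot (Dx e) (Dx e) <= p^-1 * V.
      rewrite mulrC ler_pdivlMr// mulrC; apply: le_trans V_ge.
      by rewrite lerDl mulr_ge0 ?dot_ge0// ltW.
    by have := ler_wpM2l k0 xV; lra.
move=> e u; rewrite mulNr opprK.
exact: error_system_dissipation.
Qed.
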